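(* Consider, for a Jeffrey conditional $f_\to$ with associated consequence relation $\models_{\mathsf{J}/\mathsf{TT}}$, the two schemata (over all formulae $A,B$): (a) $\neg(A\to B)\models_{\mathsf{J}/\mathsf{TT}} A\to\neg B$; (b) $A\to\neg B\models_{\mathsf{J}/\mathsf{TT}}\neg(A\to B)$. Among all Jeffrey conditionals, the Cooper-Cantwell conditional $\mathsf{CC}$ is the only one that validates the full commutation schema for negation, i.e. both (a) and (b) for all formulae $A,B$. Moreover, for the four de Finettian Jeffrey conditionals: $\mathsf{CC}$ validates both (a) and (b); $\mathsf{F}$ validates (b) but not (a); $\mathsf{J1}$ validates neither (a) nor (b); $\mathsf{J2}$ validates (a) but not (b).
   Context: Let $\mathcal{L}_{\to}$ be the propositional language with denumerably many propositional variables $p_0, p_1, \dots$ and connectives $\neg$, $\wedge$, $\to$, and let $\mathsf{For}$ be its set of formulae. Truth values are $1$, $\tfrac12$, $0$. Negation and conjunction are Strong Kleene: $f_\neg(x) = 1-x$, $f_\wedge(x,y)=\min(x,y)$. A Jeffrey conditional is a binary operation $f_\to$ on $\{1,\tfrac12,0\}$ (first argument: antecedent; second: consequent) with $f_\to(1,1)=1$, $f_\to(1,\tfrac12)=d_1$, $f_\to(1,0)=0$, $f_\to(\tfrac12,1)=d_2$, $f_\to(\tfrac12,\tfrac12)=d_3$, $f_\to(\tfrac12,0)=0$, $f_\to(0,1)=\tfrac12$, $f_\to(0,\tfrac12)=d_4$, $f_\to(0,0)=\tfrac12$, where $d_1,d_2,d_3,d_4\in\{\tfrac12,1\}$. It is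 de Finettian if $d_1=d_4=\tfrac12$. The four de Finettian Jeffrey conditionals are: $\mathsf{CC}$ (Cooper-Cantwell), $d_2=1$, $d_3=\tfrac12$; $\mathsf{F}$ (Farrell), $d_2=\tfrac12$, $d_3=\tfrac12$; $\mathsf{J1}$, $d_2=\tfrac12$, $d_3=1$; $\mathsf{J2}$, $d_2=1$, $d_3=1$. Given a Jeffrey conditional $f_\to$, a $\mathsf{J}$-evaluation is a function $v:\mathsf{For}\to\{1,\tfrac12,0\}$ interpreting $\neg,\wedge,\to$ by $f_\neg,f_\wedge,f_\to$ (with arbitrary values on the propositional variables). $\Gamma\models_{\mathsf{J}/\mathsf{TT}} A$ means: every $\mathsf{J}$-evaluation $v$ with $v(C)>0$ for all $C\in\Gamma$ satisfies $v(A)>0$. A schema is validated if it holds for all formulae $A,B$, and not validated if it fails for some formulae $A,B$. *)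

(* Defs.v *)
From mathcomp Require Import all_boot all_order all_algebra.
From mathcomp Require Import classical_sets.
Set Implicit Arguments.
Unset Strict Implicit.
Unset Printing Implicit Defensive.
Import Order.TTheory GRing.Theory Num.Theory.
Local Open Scope ring_scope.

Inductive form : Type :=
  | Var of nat
  | Neg of form
  | And of form & form
  | Imp of form & form.

Inductive tv : Type := One | Half | Zero.

Definition tv_rat (x : tv) : rat :=
  match x with One => 1 | Half => 1 / 2%:R | Zero => 0 end.

Definition f_neg (x : tv) : tv :=
  match x with One => Zero | Half => Half | Zero => One end.

Definition f_and (x y : tv) : tv :=
  match x, y with
  | Zero, _ | _, Zero => Zero
  | Half, _ | _, Half => Half
  | One, One => One
  end.

Lemma tv_rat_neg (x : tv) : tv_rat (f_neg x) = 1 - tv_rat x.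
Proof. by case: x; apply/eqP. Qed.

Lemma tv_rat_and (x y : tv) :
  tv_rat (f_and x y) = Num.min (tv_rat x) (tv_rat y).
Proof. by case: x; case: y; apply/eqP. Qed.

(* First argument: antecedent; second argument: consequent. *)
Definition jeffrey_op (d1 d2 d3 d4 : tv) (x y : tv) : tv :=
  match x, y with
  | One,  One => One  | One,  Half => d1 | One,  Zero => Zero
  | Half, One => d2   | Half, Half => d3 | Half, Zero => Zero
  | Zero, One => Half | Zero, Half => d4 | Zero, Zero => Half
  end.

Definition half_or_one (d : tv) : Prop := d = Half \/ d = One.

Definition jeffrey (f : tv -> tv -> tv) : Prop :=
  exists d1 d2 d3 d4 : tv,
    [/\ half_or_one d1, half_or_one d2, half_or_one d3, half_or_one d4
      & f =2 jeffrey_op d1 d2 d3 d4].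

Definition de_finettian (f : tv -> tv -> tv) : Prop :=
  [/\ jeffrey f, f One Half = Half & f Zero Half = Half].

Definition CC : tv -> tv -> tv := jeffrey_op Half One  Half Half.
Definition F  : tv -> tv -> tv := jeffrey_op Half Half Half Half.
Definition J1 : tv -> tv -> tv := jeffrey_op Half Half One  Half.
Definition J2 : tv -> tv -> tv := jeffrey_op Half One  One  Half.

Lemma de_finettianP (f : tv -> tv -> tv) :
  de_finettian f <-> [\/ f =2 CC, f =2 F, f =2 J1 | f =2 J2].
Proof.
split.
  move=> [[d1 [d2 [d3 [d4 [_ h2 h3 _ fE]]]]]]; rewrite !fE /= => e1 e4.
  by case: h2 fE => ->; case: h3 => ->; rewrite e1 e4 => fE;
    [apply: Or42 | apply: Or43 | apply: Or41 | apply: Or44].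
by case=> fE; (split; last 2 first; [by rewrite fE | by rewrite fE |]);
  [exists Half, One, Half, Half | exists Half, Half, Half, Half
  | exists Half, Half, One, Half | exists Half, One, One, Half];
  split=> //; first [by left | by right].
Qed.

Definition evaluation (f : tv -> tv -> tv) (v : form -> tv) : Prop :=
  [/\ forall A, v (Neg A) = f_neg (v A),
      forall A B, v (And A B) = f_and (v A) (v B)
    & forall A B, v (Imp A B) = f (v A) (v B)].

(* Tolerant-tolerant consequence: the nonzero values are designated. *)
Definition TTconseq (f : tv -> tv -> tv) (Gamma : set form) (A : form) :
    Prop :=
  forall v : form -> tv, evaluation f v ->
    (forall C, Gamma C -> 0 < tv_rat (v C)) -> 0 < tv_rat (v A).

Definition schema_a (f : tv -> tv -> tv) (A B : form) : Prop :=
  TTconseq f [set Neg (Imp A B)]%classic (Imp A (Neg B)).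

Definition schema_b (f : tv -> tv -> tv) (A B : form) : Prop :=
  TTconseq f [set Imp A (Neg B)]%classic (Neg (Imp A B)).

Definition validated (S : form -> form -> Prop) : Prop :=
  forall A B, S A B.

Definition not_validated (S : form -> form -> Prop) : Prop :=
  exists A B, ~ S A B.

(* Main.v *)
Require Import Defs.
From mathcomp Require Import all_boot all_order all_algebra.
From mathcomp Require Import classical_sets.

(** A Jeffrey conditional takes the value 0 exactly when the antecedent is nonzero and the
consequent is 0.  Hence (a) can only fail at the values (1/2, 1), and amounts to
[d2 = 1]; while (b) says that the value 1 is never taken on a consequent 1/2,
i.e. [d1 = d3 = d4 = 1/2]. *)

Fixpoint eval (f : tv -> tv -> tv) (e : nat -> tv) (A : Defs.form) : tv :=
  match A with
  | Var n => e n
  | Neg A => f_neg (eval f e A)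
  | And A B => f_and (eval f e A) (eval f e B)
  | Imp A B => f (eval f e A) (eval f e B)
  end.

(** Any assignment to the variables extends to an evaluation, so a bad pair of truth values becomes
    a countermodel. *)
Lemma eval_evaluation f e : evaluation f (eval f e).
Proof. by []. Qed.

Lemma tv_rat_gt0 x : (0 < tv_rat x)%R <-> x <> Zero.
Proof. by case: x. Qed.

Lemma f_neg_eq0 x : f_neg x = Zero <-> x = One.
Proof. by case: x. Qed.

Lemma TTconseq1P f C A :
  TTconseq f [set C]%classic A <->
  forall v, evaluation f v -> v C <> Zero -> v A <> Zero.
Proof.
split=> H v ev.
  move=> vC; apply/tv_rat_gt0; apply: H => // _ ->; exact/tv_rat_gt0.
by move=> vC; apply/tv_rat_gt0; apply: H => //; apply/tv_rat_gt0/vC.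
Qed.

(** A negation is designated exactly when the negated formula is not [One]; this turns (a) into a
    condition on the table of [f]. *)
Lemma schema_aP f A B :
  schema_a f A B <->
  forall v, evaluation f v ->
    f (v A) (v B) <> One -> f (v A) (f_neg (v B)) <> Zero.
Proof.
split=> [/TTconseq1P H v ev | H]; last apply/TTconseq1P => v ev.
  by have [vN _ vI] := ev; rewrite -vN -!vI -f_neg_eq0 -vN; apply: H.
by have [vN _ vI] := ev; rewrite vN !vI vN f_neg_eq0; apply: H.
Qed.

Lemma schema_bP f A B :
  schema_b f A B <->
  forall v, evaluation f v ->
    f (v A) (f_neg (v B)) <> Zero -> f (v A) (v B) <> One.
Proof.
split=> [/TTconseq1P H v ev | H]; last apply/TTconseq1P => v ev.
  by have [vN _ vI] := ev; rewrite -vN -!vI -f_neg_eq0 -vN; apply: H.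
by have [vN _ vI] := ev; rewrite vN !vI vN f_neg_eq0; apply: H.
Qed.

Definition env2 (x y : tv) (n : nat) : tv := if n is 0 then x else y.

(** Two distinct variables take any pair of values independently, so this single instance tests the
    whole table. *)
Lemma schema_a_vars f x y :
  schema_a f (Var 0) (Var 1) -> f x y <> One -> f x (f_neg y) <> Zero.
Proof. by move/schema_aP/(_ _ (eval_evaluation f (env2 x y))). Qed.

Lemma schema_b_vars f x y :
  schema_b f (Var 0) (Var 1) -> f x (f_neg y) <> Zero -> f x y <> One.
Proof. by move/schema_bP/(_ _ (eval_evaluation f (env2 x y))). Qed.

(** The converse starts from one instance only, so its contrapositive yields explicit witnesses for
    [not_validated]. *)
Lemma validated_aP d1 d2 d3 d4 f :
    half_or_one d1 -> half_or_one d2 -> half_or_one d3 -> half_or_one d4 ->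
    f =2 jeffrey_op d1 d2 d3 d4 ->
  (d2 = One -> validated (schema_a f)) /\
  (schema_a f (Var 0) (Var 1) -> d2 = One).
Proof.
move=> h1 h2 h3 h4 fE; split=> [d2E A B | /schema_a_vars H].
  apply/schema_aP => v _; rewrite !fE d2E.
  by case: h1 => ->; case: h3 => ->; case: h4 => ->; case: (v A) (v B) => -[].
(* If [d2 = Half], then [f Half One] is not [One], yet [f Half (f_neg One)] is [Zero]. *)
by case: h2 fE => // -> fE; have := H Half One; rewrite !fE /=; case.
Qed.

Lemma validated_bP d1 d2 d3 d4 f :
    half_or_one d1 -> half_or_one d2 -> half_or_one d3 -> half_or_one d4 ->
    f =2 jeffrey_op d1 d2 d3 d4 ->
  ([/\ d1 = Half, d3 = Half & d4 = Half] -> validated (schema_b f)) /\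
  (schema_b f (Var 0) (Var 1) -> [/\ d1 = Half, d3 = Half & d4 = Half]).
Proof.
move=> h1 h2 h3 h4 fE; split=> [[d1E d3E d4E] A B | /schema_b_vars H].
  apply/schema_bP => v _; rewrite !fE d1E d3E d4E.
  by case: (v A) (v B) => -[].
(* [Half] is the fixed point of [f_neg]: there both sides of (b) speak of the same value
   [f x Half]. *)
have H1 x : f x Half <> One.
  by move=> fx1; apply: (H x Half) => //=; rewrite fx1.
have := (H1 One, H1 Half, H1 Zero); rewrite !fE /= => -[[]].
by case: h1 => ->; case: h3 => ->; case: h4 => ->.
Qed.

Theorem proposition5p7 :
  (jeffrey CC /\
   forall f : tv -> tv -> tv, jeffrey f ->
     (validated (schema_a f) /\ validated (schema_b f) <-> f =2 CC)) /\
  [/\ validated (schema_a CC) /\ validated (schema_b CC),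
      not_validated (schema_a F) /\ validated (schema_b F),
      not_validated (schema_a J1) /\ not_validated (schema_b J1)
    & validated (schema_a J2) /\ not_validated (schema_b J2)].
Proof.
have hH : half_or_one Half by left.
have hO : half_or_one One by right.
(* The de Finettian case [d1 = d4 = Half], to be used for all four named conditionals. *)
have aP d2 d3 (h2 : half_or_one d2) (h3 : half_or_one d3) :=
  validated_aP _ _ _ _ _ hH h2 h3 hH (fun x y => erefl).
have bP d2 d3 (h2 : half_or_one d2) (h3 : half_or_one d3) :=
  validated_bP _ _ _ _ _ hH h2 h3 hH (fun x y => erefl).
split; first split; first by exists Half, One, Half, Half.
  move=> f [d1 [d2 [d3 [d4 [h1 h2 h3 h4 fE]]]]].
  have [aI aE] := validated_aP _ _ _ _ _ h1 h2 h3 h4 fE.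
  have [bI bE] := validated_bP _ _ _ _ _ h1 h2 h3 h4 fE.
  split=> [[Ha Hb] x y | fCC].
    by have [d1E d3E d4E] := bE (Hb _ _); rewrite fE d1E d3E d4E (aE (Ha _ _)).
  (* The parameters are read off the table of [CC]: [d2] at [(Half, One)], the others in the column
     of consequent [Half]. *)
  split; first by apply: aI; have := fCC Half One; rewrite fE.
  by apply: bI; have := (fCC One Half, fCC Half Half, fCC Zero Half);
    rewrite !fE => -[[]].
split; split.
- exact: (aP _ _ hO hH).1.
- exact: (bP _ _ hO hH).1.
(* For [F], validity of this instance would force [Half = One]; the other failures are refuted the
   same way. *)
- by exists (Var 0), (Var 1) => /(aP _ _ hH hH).2.
- exact: (bP _ _ hH hH).1.
- by exists (Var 0), (Var 1) => /(aP _ _ hH hO).2.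
- by exists (Var 0), (Var 1) => /(bP _ _ hH hO).2 [].
- exact: (aP _ _ hO hO).1.
- by exists (Var 0), (Var 1) => /(bP _ _ hO hO).2 [].
Qed.
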